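(* Let $n \ge 2$ and let $T_1^n$ be a regular simplex in $\mathbb{E}^n$ with edge length $1$. Then \[ R_{n-1}(T_1^n) = \begin{cases} \sqrt{\dfrac{n-1}{2(n+1)}} & \text{if } n \text{ is odd},\\[2ex] \dfrac{2n-1}{2\sqrt{2n(n+1)}} & \text{if } n \text{ is even}. \end{cases} \]
   Context: $\mathbb{E}^n$ is $\mathbb{R}^n$ with the usual scalar product and Euclidean norm; $\mathbb{B}^n$ is its closed unit ball. A $k$-flat is an affine subspace of dimension $k$. For a convex body $C \subset \mathbb{E}^n$ (compact, convex, with nonempty interior) and $1 \le j \le n$, the outer $j$-radius $R_j(C)$ is the minimum, over all $j$-dimensional linear subspaces $J$ of $\mathbb{E}^n$, of the radius of the smallest enclosing $j$-dimensional ball of the orthogonal projection of $C$ onto $J$. Equivalently, $R_j(C)$ is the smallest $\rho$ such that $C \subset J' + \rho\,\mathbb{B}^n$ for some $(n-j)$-flat $J'$. In particular $R_{n-1}(C)$ is the radius of a smallest enclosing cylinder (with a line as axis) of $C$. A simplex is the convex hull of $n+1$ affinely independent points in $\mathbb{E}^n$; it is regular if all its vertices are equidistant. *)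

(* Defs.v *)
From HB Require Import structures.
From mathcomp Require Import all_boot all_order all_algebra.
From mathcomp Require Import boolp classical_sets reals.

Set Implicit Arguments.
Unset Strict Implicit.
Unset Printing Implicit Defensive.

Import Order.TTheory GRing.Theory Num.Theory.
Local Open Scope classical_set_scope.
Local Open Scope ring_scope.

Section EuclideanSpace.
Variables (R : realType) (n : nat).
Implicit Types (u v x y c : 'rV[R]_n) (C K : set 'rV[R]_n) (r : R).

Definition edot u v : R := \sum_(i < n) u 0 i * v 0 i.

(* MathComp-Analysis equips ['rV[R]_n] with the maximum norm, so the Euclidean
   norm is defined separately. *)
Definition enorm u : R := Num.sqrt (edot u u).

Definition affinely_independent (m : nat) (p : 'I_m -> 'rV[R]_n) : Prop :=
  forall a : 'I_m -> R,
    \sum_(i < m) a i = 0 -> \sum_(i < m) a i *: p i = 0 -> forall i, a i = 0.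

Definition convex_hull (m : nat) (p : 'I_m -> 'rV[R]_n) : set 'rV[R]_n :=
  [set x | exists a : 'I_m -> R,
    [/\ forall i, 0 <= a i, \sum_(i < m) a i = 1
      & x = \sum_(i < m) a i *: p i]].

Definition regular_simplex (e : R) (T : set 'rV[R]_n) : Prop :=
  exists p : 'I_n.+1 -> 'rV[R]_n,
    [/\ affinely_independent p,
        forall i j, i != j -> enorm (p i - p j) = e
      & T = convex_hull p].

Definition is_orth_proj (J : {vspace 'rV[R]_n}) x y : Prop :=
  y \in J /\ forall z, z \in J -> edot (x - y) z = 0.

Definition orth_proj (J : {vspace 'rV[R]_n}) C : set 'rV[R]_n :=
  [set y | exists2 x, C x & is_orth_proj J x y].

Definition is_minimum (A : set R) r : Prop := A r /\ lbound A r.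

(* Balls are taken inside [J], so their centers range over [J] only. *)
Definition is_circumradius (J : {vspace 'rV[R]_n}) K r : Prop :=
  is_minimum
    [set s | 0 <= s /\
       exists2 c, c \in J & forall x, K x -> enorm (x - c) <= s] r.

(* [r] is the outer [j]-radius of [C]. It is a relation rather than a function
   so that the minimum is required to be attained. For a compact nonempty [C],
   every projection has a smallest enclosing ball, so every [j]-dimensional [J]
   contributes to the minimum. Meant for [1 <= j <= n]. *)
Definition is_outer_radius (j : nat) C r : Prop :=
  is_minimum
    [set s | exists2 J : {vspace 'rV[R]_n},
       \dim J = j & is_circumradius J (orth_proj J C) s] r.

Lemma is_minimum_uniq (A : set R) r s :
  is_minimum A r -> is_minimum A s -> r = s.
Proof.
by move=> [Ar lr] [As ls]; apply/eqP; rewrite eq_le lr // ls.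
Qed.

Lemma is_outer_radius_uniq j C r s :
  is_outer_radius j C r -> is_outer_radius j C s -> r = s.
Proof. exact: is_minimum_uniq. Qed.

End EuclideanSpace.

(* Main.v *)
Require Import Defs.
From HB Require Import structures.
From mathcomp Require Import all_boot all_order all_algebra.
From mathcomp Require Import boolp classical_sets reals.
From mathcomp Require Import ring lra zify.

(* Let [N = n + 1] and let [f_i] be the vertices relative to the barycenter.
   They satisfy [f_i . f_j = (delta_ij - 1/N) / 2] and
   [sum_i (f_i . v) (f_i . w) = v . w / 2], so a unit direction [u] and an
   offset [e] orthogonal to it amount to coordinates [s_i = f_i . u] and
   [c_i = f_i . e] with [sum s = sum c = sum s c = 0] and [sum s^2 = 1/2], and
   the squared distance of the vertex [i] to the axis is
   [n/2N - s_i^2 - 2 c_i + 2 sum c^2].  After the scaling [x = sqrt(2N) s],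
   [d = 4N c], the radius is governed by the least [h] with
   [1 - x_i^2 - d_i + (sum d^2) / 4N <= h] for all [i].

   Averaging gives [h >= 0], attained for odd [n] by [x_i = +-1], [d = 0].
   For even [n] the value is [1/4n], attained when [x] takes one value [0] and
   [+-a] equally often, [a^2 = N/n].  For the lower bound, if some [x_i^2]
   exceeds [12/5], averaging with the nonnegative weights [max_j x_j^2 - x_i^2]
   suffices.  Otherwise the weights [3 - x_i^2 +- (a/4) x_i] are nonnegative and
   reduce the claim to [sum (x^2 - 1)^2 -+ (a/2) sum x^3 >= N/n].  That
   inequality expresses that a sum of [N] signs cannot vanish for odd [N]: the
   cubic [(3x/a - (x/a)^3) / 2]
   approximates the sign of [x] with error at most [(x^2/a^2 - 1)^2]. *)

Set Implicit Arguments.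
Unset Strict Implicit.
Unset Printing Implicit Defensive.

Import Order.TTheory GRing.Theory Num.Theory.
Local Open Scope classical_set_scope.
Local Open Scope ring_scope.

(** * Power-sum inequalities for families of reals *)

Lemma sgn_quartic_le (R : realFieldType) (a x : R) : 0 < a ->
  `|a ^+ 4 * (if x < 0 then -1 else 1) - (3 * a ^+ 3 * x - a * x ^+ 3) / 2|
    <= (x ^+ 2 - a ^+ 2) ^+ 2.
Proof.
have pos_case (y : R) : 0 < a -> 0 <= y ->
    `|a ^+ 4 - (3 * a ^+ 3 * y - a * y ^+ 3) / 2| <= (y ^+ 2 - a ^+ 2) ^+ 2.
  move=> a0 y0.
  (* The cubic touches the constant [a ^+ 4] at [y = a], whence the double factor [(y - a) ^+ 2].
     The cofactor is nonnegative and at most [(y + a) ^+ 2]. *)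
  have -> : a ^+ 4 - (3 * a ^+ 3 * y - a * y ^+ 3) / 2 =
    (y - a) ^+ 2 * (a * (y + 2 * a) / 2) by field.
  have -> : (y ^+ 2 - a ^+ 2) ^+ 2 = (y - a) ^+ 2 * (y + a) ^+ 2 by ring.
  have h : 0 <= a * (y + 2 * a) / 2.
    by rewrite divr_ge0 // mulr_ge0 ?(ltW a0) // addr_ge0 // mulr_ge0 // ltW.
  rewrite ger0_norm; last by rewrite mulr_ge0 ?sqr_ge0.
  apply: ler_wpM2l; first exact: sqr_ge0.
  rewrite -subr_ge0.
  have -> : (y + a) ^+ 2 - a * (y + 2 * a) / 2 = y ^+ 2 + 3 / 2 * (a * y).
    by field.
  by rewrite addr_ge0 ?sqr_ge0 // mulr_ge0 ?divr_ge0 // mulr_ge0 // ltW.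
move=> a0; case: ltP => x0; last by rewrite mulr1; exact: pos_case.
have x0' : 0 <= - x by rewrite oppr_ge0 ltW.
have -> : a ^+ 4 * -1 - (3 * a ^+ 3 * x - a * x ^+ 3) / 2 =
  - (a ^+ 4 - (3 * a ^+ 3 * - x - a * (- x) ^+ 3) / 2) by field.
by rewrite normrN -(sqrrN x); exact: pos_case.
Qed.

(** With [k] negative terms the sum is [m - 2 * k], an odd integer. Zero counts as positive, so that
    every term is a sign. *)
Lemma sum_sgn_odd (R : realFieldType) (m : nat) (x : 'I_m -> R) : odd m ->
  let S : R := \sum_i (if x i < 0 then -1 else 1) in 1 <= S \/ S <= -1.
Proof.
move=> om S; pose k := #|[pred i | x i < 0]|.
have -> : S = m%:R - 2 * k%:R.
  rewrite /S (eq_bigr (fun i => 1 - 2 * (if x i < 0 then 1 else 0))); last first.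
    by move=> i _; case: ifP => _; ring.
  by rewrite big_split /= sumr_const card_ord sumrN -mulr_sumr -big_mkcond /=
    sumr_const.
have [h|h] : (2 * k + 1 <= m)%N \/ (m + 1 <= 2 * k)%N by lia.
  by left; move: h; rewrite -(ler_nat R) natrD natrM; lra.
by right; move: h; rewrite -(ler_nat R) natrD natrM; lra.
Qed.

Section Moments.
Variables (R : rcfType) (n : nat).
Implicit Types x d : 'I_n.+1 -> R.

Let N : R := n.+1%:R.

Let sum1 (c : R) : \sum_(i < n.+1) c = N * c.
Proof. by rewrite sumr_const card_ord mulr_natl. Qed.

(** When [sgn_quartic_le] is summed over [i], the linear part of the cubic vanishes with
    [\sum_i x i]. The witness [e] is the sign of the sum of signs [S]. *)
Lemma quartic_parity_bound (a : R) x : (0 < n)%N -> ~~ odd n -> 0 < a ->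
  a ^+ 2 * n%:R = N -> \sum_i x i = 0 -> \sum_i x i ^+ 2 = N ->
  exists2 e : R, e = 1 \/ e = -1 &
    N / n%:R <= \sum_i (x i ^+ 2 - 1) ^+ 2 - e * a / 2 * \sum_i x i ^+ 3.
Proof.
move=> n0 en a0 ha x1 x2.
have nR : 0 < n%:R :> R by rewrite ltr0n.
have NE : N = n%:R + 1 by rewrite /N -natr1.
pose S : R := \sum_i (if x i < 0 then -1 else 1).
have A2 : \sum_i (x i ^+ 2 - a ^+ 2) ^+ 2 =
    \sum_i (x i ^+ 2 - 1) ^+ 2 + N * (a ^+ 2 - 1) ^+ 2.
  rewrite (eq_bigr (fun i => (x i ^+ 2 - 1) ^+ 2 + 2 * (1 - a ^+ 2) * x i ^+ 2
    + (a ^+ 4 - 1))); last by move=> i _; ring.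
  rewrite 2!big_split /= sum1 -mulr_sumr x2; ring.
have leS : `|a ^+ 4 * S + a / 2 * \sum_i x i ^+ 3| <=
    \sum_i (x i ^+ 2 - a ^+ 2) ^+ 2.
  have -> : a ^+ 4 * S + a / 2 * \sum_i x i ^+ 3 = \sum_i
    (a ^+ 4 * (if x i < 0 then -1 else 1) -
      (3 * a ^+ 3 * x i - a * x i ^+ 3) / 2).
    rewrite [RHS](eq_bigr (fun i => a ^+ 4 * (if x i < 0 then -1 else 1)
      + (- (3 * a ^+ 3 / 2)) * x i + a / 2 * x i ^+ 3)).
      by rewrite !big_split /= -!mulr_sumr x1 mulr0 addr0.
    by move=> i _; field.
  apply: le_trans (ler_norm_sum _ _ _) _.
  by apply: ler_sum => i _; exact: sgn_quartic_le.
have E : N / n%:R = a ^+ 4 - N * (a ^+ 2 - 1) ^+ 2.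
  have a2 : a ^+ 2 = N / n%:R by rewrite -ha mulfK // gt_eqF.
  rewrite (exprM a 2 2) a2 NE; field.
  by rewrite gt_eqF.
move: leS; rewrite A2 ler_norml E => /andP[l1 l2].
have a4 : 0 <= a ^+ 4 by rewrite exprn_ge0 // ltW.
have [h|h] : 1 <= S \/ S <= -1 by apply: sum_sgn_odd; rewrite /= en.
  exists 1; first by left.
  have := ler_wpM2l a4 h; lra.
exists (-1); first by right.
have := ler_wpM2l a4 h; lra.
Qed.

Lemma mean_bound (h : R) x d :
  \sum_i x i ^+ 2 = N -> \sum_i d i = 0 ->
  (forall i, 1 - x i ^+ 2 - d i + (\sum_j d j ^+ 2) / N / 4 <= h) -> 0 <= h.
Proof.
move=> x2 d1 hle; set D := (\sum_j d j ^+ 2) / N / 4 in hle.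
have D0 : 0 <= D by rewrite !divr_ge0 // sumr_ge0 // => i _; exact: sqr_ge0.
have N0 : 0 < N by rewrite ltr0n.
have : \sum_i (1 - x i ^+ 2 - d i + D) <= \sum_(i < n.+1) h by exact: ler_sum.
rewrite 2!big_split /= big_split /= !sumrN x2 d1 !sum1 mulr1 subrr subr0 add0r.
by rewrite ler_pM2l //; exact: le_trans.
Qed.

(* The constraints are averaged with the weights [K + 1 - x i ^+ 2 + k * x i];
   completing the square in [d] then eliminates it. *)
Lemma weighted_bound (k h K : R) x d :
  \sum_i x i = 0 -> \sum_i x i ^+ 2 = N ->
  \sum_i d i = 0 -> \sum_i d i * x i = 0 -> 0 < K ->
  (forall i, 0 <= K + 1 - x i ^+ 2 + k * x i) ->
  (forall i, 1 - x i ^+ 2 - d i + (\sum_j d j ^+ 2) / N / 4 <= h) ->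
  (1 - K^-1) * \sum_i (x i ^+ 2 - 1) ^+ 2 - k * \sum_i x i ^+ 3 <= N * K * h.
Proof.
move=> x1 x2 d1 dx K0 w0 hle.
have N0 : N != 0 by rewrite pnatr_eq0.
set D := (\sum_j d j ^+ 2) / N / 4 in hle *.
have ND : N * D = (\sum_j d j ^+ 2) / 4 by rewrite /D mulrA (mulrC N) divfK.
have K0' : K != 0 by rewrite gt_eqF.
have : 0 <= \sum_i (K + 1 - x i ^+ 2 + k * x i) *
    (h - (1 - x i ^+ 2 - d i + D)).
  by apply: sumr_ge0 => i _; rewrite mulr_ge0 // subr_ge0.
have : 0 <= \sum_i K / 4 * (d i + 2 / K * (x i ^+ 2 - 1)) ^+ 2.
  by apply: sumr_ge0 => i _; rewrite mulr_ge0 ?sqr_ge0 // divr_ge0 // ltW.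
move=> p q; have := addr_ge0 p q; rewrite -big_split /=.
rewrite (eq_bigr (fun i => - (1 - K^-1) * (x i ^+ 2 - 1) ^+ 2 + k * x i ^+ 3
    + K / 4 * d i ^+ 2 + K * d i + k * (d i * x i)
    + k * (h - 1 - D) * x i + (K + D - h) * x i ^+ 2
    + ((K + 1) * (h - D) - K))); last first.
  by move=> i _; field.
rewrite 7!big_split /= sum1 -!mulr_sumr d1 dx x1 x2 !mulr0 !addr0.
rewrite (_ : N * _ = N * K * h - K * (N * D) + N * (h - K - D)); last by ring.
rewrite ND; lra.
Qed.

Lemma spread_bound (h : R) x d : (1 < n)%N -> ~~ odd n ->
  \sum_i x i = 0 -> \sum_i x i ^+ 2 = N ->
  \sum_i d i = 0 -> \sum_i d i * x i = 0 ->
  (forall i, 1 - x i ^+ 2 - d i + (\sum_j d j ^+ 2) / N / 4 <= h) ->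
  (4 * n%:R)^-1 <= h.
Proof.
move=> n1 en x1 x2 d1 dx hle.
have nR : 2 <= n%:R :> R by rewrite ler_nat.
have n0 : 0 < n%:R :> R by lra.
have NE : N = n%:R + 1 by rewrite /N -natr1.
(* The threshold [12 / 5] serves both cases: above it, [K - 1 >= 2 / 5] contradicts a small [h];
   below it, [3 - x i ^+ 2] is at least [3 / 5], which dominates the linear part of the weight. *)
have [[i0 hi0]|small] := pselect (exists i, 12 / 5 < x i ^+ 2).
  pose j := [arg max_(i > i0) (x i ^+ 2)]%O.
  have jmax i : x i ^+ 2 <= x j ^+ 2.
    by rewrite /j; case: arg_maxP => // m _; exact.
  pose K := x j ^+ 2 - 1.
  have K0 : 7 / 5 <= K by have := jmax i0; rewrite /K; lra.
  have := @weighted_bound 0 h K x d x1 x2 d1 dx.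
  have A0 : K ^+ 2 <= \sum_i (x i ^+ 2 - 1) ^+ 2.
    by rewrite (bigD1 j) //= lerDl sumr_ge0 // => i _; exact: sqr_ge0.
  have K0' : 0 < K by lra.
  have w0 i : 0 <= K + 1 - x i ^+ 2 + 0 * x i.
    by have := jmax i; rewrite /K; lra.
  move=> /(_ K0' w0 hle); rewrite mul0r subr0 => B.
  have K1 : 0 <= 1 - K^-1.
    by rewrite subr_ge0 invf_le1 //; lra.
  have := le_trans (ler_wpM2l K1 A0) B.
  have -> : (1 - K^-1) * K ^+ 2 = K * (K - 1) by field; rewrite gt_eqF.
  rewrite [N * K]mulrC -mulrA ler_pM2l // => C.
  pose t : R := (4 * n%:R)^-1.
  have t1 : t * (4 * n%:R) = 1 by rewrite mulVf // mulf_neq0 ?gt_eqF.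
  have t8 : t <= 1 / 8 by nra.
  (* If [h < t], then [N * h < 1 / 4 + t <= 3 / 8], whereas [N * h >= K - 1 >= 2 / 5]. *)
  rewrite -/t leNgt; apply/negP => ht; rewrite NE in C; nra.
pose a : R := Num.sqrt (N / n%:R).
have N0 : 0 < N by rewrite ltr0n.
have a0 : 0 < a by rewrite sqrtr_gt0 divr_gt0.
have aE : a ^+ 2 = N / n%:R by rewrite sqr_sqrtr // divr_ge0 // ltW.
have a2 : a ^+ 2 * n%:R = N by rewrite aE divfK // gt_eqF.
have [|e e1 eb] := quartic_parity_bound _ en a0 a2 x1 x2.
  by rewrite (ltn_trans _ n1).
(* With [K = 2] and [k = e * a / 4], the left side of [weighted_bound] is half the quantity
   estimated in [quartic_parity_bound]. *)
have w0 i : 0 <= 2 + 1 - x i ^+ 2 + e * a / 4 * x i.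
  have xs : x i ^+ 2 <= 12 / 5.
    by rewrite leNgt; apply/negP => xb; apply: small; exists i.
  have a32 : a ^+ 2 <= 3 / 2 by rewrite aE ler_pdivrMr // NE; lra.
  have ax : (a * x i) ^+ 2 <= (12 / 5) ^+ 2.
    rewrite exprMn; have := sqr_ge0 (x i); have := sqr_ge0 a; nra.
  have l1 : - (12 / 5) <= a * x i by nra.
  have l2 : a * x i <= 12 / 5 by nra.
  case: e1 => ->; lra.
have := weighted_bound x1 x2 d1 dx (ltr0n R 2) w0 hle => B.
have : N * (1 / n%:R) <= N * (4 * h).
  by rewrite mul1r; lra.
rewrite ler_pM2l // ler_pdivrMr // => H.
rewrite -[leLHS]mul1r ler_pdivrMr ?mulr_gt0 //; lra.
Qed.
End Moments.

(** * Scalar product, orthogonal projections and hyperplanes *)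

Section Euclidean.
Variables (R : realType) (n : nat).
Implicit Types (u v w x y z : 'rV[R]_n) (J : {vspace 'rV[R]_n}).

Lemma edotC u v : edot u v = edot v u.
Proof. by apply: eq_bigr => i _; rewrite mulrC. Qed.

Lemma edotDl u v w : edot (u + v) w = edot u w + edot v w.
Proof. by rewrite -big_split; apply: eq_bigr => i _; rewrite mxE mulrDl. Qed.

Lemma edotZl a u v : edot (a *: u) v = a * edot u v.
Proof. by rewrite mulr_sumr; apply: eq_bigr => i _; rewrite mxE mulrA. Qed.

Lemma edotBl u v w : edot (u - v) w = edot u w - edot v w.
Proof. by rewrite edotDl -scaleN1r edotZl mulN1r. Qed.

Lemma edot0l u : edot 0 u = 0.
Proof. by rewrite -(scale0r 0) edotZl mul0r. Qed.

Lemma edot_suml (I : finType) (F : I -> 'rV[R]_n) v :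
  edot (\sum_i F i) v = \sum_i edot (F i) v.
Proof. exact: (big_morph _ (fun x y => edotDl x y v) (edot0l v)). Qed.

Lemma edotZr a u v : edot u (a *: v) = a * edot u v.
Proof. by rewrite edotC edotZl edotC. Qed.

Lemma edotBr u v w : edot u (v - w) = edot u v - edot u w.
Proof. by rewrite edotC edotBl !(edotC u). Qed.

Lemma edotE u v : edot u v = (u *m v^T) 0 0.
Proof. by rewrite mxE; apply: eq_bigr => i _; rewrite mxE. Qed.

Lemma edot_ge0 u : 0 <= edot u u.
Proof. by apply: sumr_ge0 => i _; rewrite -expr2 sqr_ge0. Qed.

Lemma edot_eq0 u : edot u u = 0 -> u = 0.
Proof.
move=> u0; apply/rowP => i; rewrite mxE; apply/eqP.
have /eqP := u0; rewrite psumr_eq0; last first.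
  by move=> j _; rewrite -expr2 sqr_ge0.
by move=> /allP /(_ i (mem_index_enum i)); rewrite mulf_eq0 orbb.
Qed.

Lemma enorm_le u (s : R) : 0 <= s -> (enorm u <= s) = (edot u u <= s ^+ 2).
Proof.
by move=> s0; rewrite -[s in LHS]ger0_norm // -sqrtr_sqr ler_sqrt ?sqr_ge0.
Qed.

(** The weighted variance of the points about their mean [y] is nonnegative and equals
    [\sum_i a i * edot (z i) (z i) - edot y y]. Hence a ball around the projected simplex need only
    be checked at the vertices. *)
Lemma edot_convex_le (m : nat) (a : 'I_m -> R) (z : 'I_m -> 'rV[R]_n) (b : R) :
  (forall i, 0 <= a i) -> \sum_i a i = 1 -> (forall i, edot (z i) (z i) <= b) ->
  edot (\sum_i a i *: z i) (\sum_i a i *: z i) <= b.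
Proof.
move=> a0 a1 zb; set y := \sum_i a i *: z i.
have : 0 <= \sum_i a i * edot (z i - y) (z i - y).
  by apply: sumr_ge0 => i _; rewrite mulr_ge0 // edot_ge0.
have -> : \sum_i a i * edot (z i - y) (z i - y) =
    \sum_i a i * edot (z i) (z i) - edot y y.
  have -> : edot y y = 2 * \sum_i a i * edot (z i) y - \sum_i a i * edot y y.
    rewrite -mulr_suml a1 (eq_bigr (fun i => edot (a i *: z i) y)).
      by rewrite -edot_suml -/y; ring.
    by move=> i _; rewrite edotZl.
  rewrite mulr_sumr opprB addrA -big_split -sumrB; apply: eq_bigr => i _ /=.
  by rewrite edotBl !edotBr (edotC y (z i)); ring.
rewrite subr_ge0 => /le_trans; apply.
rewrite -[b]mul1r -a1 mulr_suml; apply: ler_sum => i _.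
by rewrite ler_wpM2l.
Qed.

Lemma is_orth_proj_uniq J x y z :
  is_orth_proj J x y -> is_orth_proj J x z -> y = z.
Proof.
move=> [yJ hy] [zJ hz]; apply/eqP; rewrite -subr_eq0; apply/eqP/edot_eq0.
have yzJ : y - z \in J by rewrite rpredB.
have -> : edot (y - z) (y - z) = edot (x - z) (y - z) - edot (x - y) (y - z).
  by rewrite -edotBl; congr (edot _ _); rewrite opprB [RHS]addrC subrKA.
by rewrite hy // hz // subrr.
Qed.

(** The codomain [R^o] is the field as a one-dimensional space over itself, so that [linfun] and
    [lker] apply. *)
Definition edot_form u (v : 'rV[R]_n) : R^o := edot v u.

Lemma edot_form_linear u : linear (edot_form u).
Proof. by move=> a x y; rewrite /edot_form edotDl edotZl. Qed.

HB.instance Definition _ u :=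
  GRing.isLinear.Build R 'rV[R]_n R^o _ (edot_form u) (edot_form_linear u).

Definition hyperplane u : {vspace 'rV[R]_n} := lker (linfun (edot_form u)).

Lemma mem_hyperplane u z : (z \in hyperplane u) = (edot z u == 0).
Proof. by rewrite memv_ker lfunE. Qed.

Lemma dim_hyperplane u : u != 0 -> \dim (hyperplane u) = n.-1.
Proof.
move=> u0; have := limg_ker_dim (linfun (edot_form u)) fullv.
rewrite capfv dimvf /dim /= mul1n.
have : (\dim (limg (linfun (edot_form u))) <= 1)%N.
  by rewrite (leq_trans (dimvS (subvf _))) // dimvf.
have : (0 < \dim (limg (linfun (edot_form u))))%N.
  rewrite lt0n dimv_eq0; apply: contra u0 => /eqP im0.
  have : linfun (edot_form u) u \in limg (linfun (edot_form u)).
    by rewrite memv_img // memvf.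
  by rewrite im0 memv0 lfunE => /eqP /edot_eq0 ->.
rewrite /hyperplane; case: (\dim (limg _)) => [|[|k]] // _ _.
by rewrite addn1 => h; rewrite -[in RHS]h.
Qed.

(** A basis of [J], written as the columns of [B], has fewer than [n] members, so some nonzero row
    [v] annihilates it. Then [J] lies in the hyperplane of [v], and the dimensions agree. *)
Lemma hyperplaneP J : (0 < n)%N -> \dim J = n.-1 ->
  exists2 u, edot u u = 1 & J = hyperplane u.
Proof.
move=> n0 dJ; pose b := vbasis J.
pose B : 'M[R]_(n, \dim J) := \matrix_(i, j) b`_j 0 i.
have : kermx B != 0.
  rewrite -mxrank_eq0 mxrank_ker subn_eq0 -ltnNge.
  by rewrite (leq_ltn_trans (rank_leq_col B)) // dJ prednK.
case/rowV0Pn => v /sub_kermxP vB v0.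
have vv : 0 < edot v v.
  by rewrite lt_def edot_ge0 andbT; apply: contra v0 => /eqP /edot_eq0 ->.
exists ((Num.sqrt (edot v v))^-1 *: v).
  rewrite edotZl edotZr mulrA -expr2 exprVn sqr_sqrtr ?ltW // mulVf //.
  by rewrite gt_eqF.
set u := _ *: v.
have u0 : u != 0 by rewrite scaler_eq0 negb_or v0 andbT invr_eq0 sqrtr_eq0 -ltNge.
apply/eqP; rewrite eqEdim dim_hyperplane // dJ leqnn andbT.
apply/subvP => z zJ; rewrite mem_hyperplane edotZr (coord_vbasis zJ).
rewrite edot_suml big1 ?mulr0 // => i _.
rewrite edotZl edotC edotE.
have -> : (v *m ((vbasis J)`_i)^T) 0 0 = (v *m B) 0 i.
  by rewrite !mxE; apply: eq_bigr => j _; rewrite !mxE.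
by rewrite vB mxE mulr0.
Qed.

Lemma is_orth_proj_hyperplane u x : edot u u = 1 ->
  is_orth_proj (hyperplane u) x (x - edot x u *: u).
Proof.
move=> u1; split; first by rewrite mem_hyperplane edotBl edotZl u1 mulr1 subrr.
move=> z; rewrite mem_hyperplane => /eqP zu.
by rewrite subKr edotZl (edotC u) zu mulr0.
Qed.

Lemma convex_hull_vertex (m : nat) (p : 'I_m -> 'rV[R]_n) i :
  convex_hull p (p i).
Proof.
exists (fun j => (j == i)%:R); split.
- by move=> j; case: eqP.
- by rewrite (bigD1 i) //= eqxx big1 ?addr0 // => j /negPf ->.
rewrite (bigD1 i) //= eqxx scale1r big1 ?addr0 // => j /negPf ->.
by rewrite scale0r.
Qed.

End Euclidean.

(** * The vertices of a regular simplex as a tight frame *)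

Section Simplex.
Variables (R : realType) (n : nat) (p : 'I_n.+1 -> 'rV[R]_n).
Hypothesis p_indep : affinely_independent p.
Hypothesis p_dist : forall i j, i != j -> enorm (p i - p j) = 1.
Implicit Types (v w : 'rV[R]_n).

Let N : R := n.+1%:R.
Let N0 : N != 0. Proof. by rewrite pnatr_eq0. Qed.
Let NE : N = n%:R + 1. Proof. by rewrite /N -natr1. Qed.
Let N1 : 1 + n%:R != 0 :> R. Proof. by rewrite addrC natr1. Qed.
Let sum1 (c : R) : \sum_(i < n.+1) c = N * c.
Proof. by rewrite sumr_const card_ord mulr_natl. Qed.

Definition barycenter := N^-1 *: \sum_i p i.
Definition arm i := p i - barycenter.

Lemma sum_arm : \sum_i arm i = 0.
Proof.
rewrite sumrB sumr_const card_ord -scaler_nat /barycenter scalerA.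
by rewrite mulfV // scale1r subrr.
Qed.

Lemma sum_edot_arm v : \sum_i edot (arm i) v = 0.
Proof. by rewrite -edot_suml sum_arm edot0l. Qed.

Lemma edot_arm_sub i j :
  edot (arm i) (arm i) + edot (arm j) (arm j) - 2 * edot (arm i) (arm j)
  = (i != j)%:R.
Proof.
have -> : edot (arm i) (arm i) + edot (arm j) (arm j)
    - 2 * edot (arm i) (arm j) = edot (p i - p j) (p i - p j).
  have -> : p i - p j = arm i - arm j by rewrite /arm opprB addrA subrK.
  move: (arm i) (arm j) => v w.
  by rewrite edotBl !edotBr (edotC w v); ring.
case: eqVneq => [->|ij]; first by rewrite subrr edot0l.
have := p_dist ij; rewrite /enorm => h.
by rewrite -[LHS]sqr_sqrtr ?edot_ge0 // h expr1n.
Qed.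

(** Summing the squared distances from one vertex cancels the mixed products, since the arms sum to
    zero. A second summation gives the total [S] of the squared arm lengths, then each length, then
    each product. *)
Lemma edot_arm i j : edot (arm i) (arm j) = ((i == j)%:R - N^-1) / 2.
Proof.
pose q i := edot (arm i) (arm i); pose S := \sum_i q i.
have row_sum k : N * q k + S = n%:R.
  have : \sum_j (q k + q j - 2 * edot (arm k) (arm j)) = \sum_j (k != j)%:R.
    by apply: eq_bigr => l _; exact: edot_arm_sub.
  rewrite sumrB big_split /= sum1 -mulr_sumr.
  have -> : \sum_l edot (arm k) (arm l) = 0.
    by rewrite -[RHS](sum_edot_arm (arm k)); apply: eq_bigr => l _; rewrite edotC.
  rewrite mulr0 subr0 => ->; rewrite (eq_bigr (fun l => 1 - (l == k)%:R)); last first.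
    by move=> l _; rewrite eq_sym; case: eqP; rewrite ?subrr ?subr0.
  rewrite sumrB sum1 (bigD1 k) //= eqxx big1 => [|l /negPf -> //].
  by rewrite /= NE; lra.
have hS : S = n%:R / 2.
  have : \sum_(k < n.+1) (N * q k + S) = \sum_(k < n.+1) n%:R.
    by apply: eq_bigr => k _; rewrite row_sum.
  rewrite big_split /= -mulr_sumr -/S !sum1 -mulrDr => /(mulfI N0); lra.
have hq k : q k = n%:R / (2 * N).
  apply: (mulfI N0); have := row_sum k; rewrite hS => h.
  have -> : N * q k = n%:R / 2 by lra.
  by field.
have := edot_arm_sub i j; rewrite -!/(q _) !hq => h.
have -> : edot (arm i) (arm j) = n%:R / (2 * N) - (i != j)%:R / 2.
  by move: h => <-; field.
have -> : n%:R = N - 1 :> R by rewrite NE addrK.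
by case: eqP => _ /=; field.
Qed.

Let F : 'M[R]_(n.+1, n) := \matrix_i arm i.

(** A linear relation among the arms, with its mean subtracted from the coefficients, becomes an
    affine relation among the vertices. So all relations are constant, and the rank is at least
    [n]. *)
Lemma arm_mx_full : row_full F.
Proof.
have kerF : (kermx F <= (const_mx 1 : 'rV[R]_n.+1))%MS.
  apply/row_subP => k; set u := row k _.
  have uF : u *m F = 0 by apply/sub_kermxP; exact: row_sub.
  have uarm : \sum_i u 0 i *: arm i = 0.
    by rewrite -[RHS]uF mulmx_sum_row; apply: eq_bigr => i _; rewrite rowK.
  pose m := N^-1 * \sum_i u 0 i.
  have um i : u 0 i = m.
    apply/eqP; rewrite -subr_eq0; apply/eqP.
    apply: (p_indep (a := fun i => u 0 i - m)).
      by rewrite sumrB sum1 mulrA mulfV // mul1r subrr.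
    rewrite -[RHS]uarm; under eq_bigr do rewrite scalerBl.
    under [RHS]eq_bigr do rewrite scalerBr.
    rewrite !sumrB -scaler_sumr -scaler_suml /barycenter scalerA.
    by rewrite [m]mulrC.
  have -> : u = m *: const_mx 1.
    by apply/rowP => i; rewrite um !mxE mulr1.
  exact: scalemx_sub.
have := leq_trans (mxrankS kerF) (rank_leq_row _).
rewrite mxrank_ker leq_subLR addn1 ltnS => h.
by rewrite -col_leq_rank.
Qed.

(** The Gram matrix [F *m F^T] acts as [2^-1] on zero-sum vectors, hence on the image of the arms;
    full rank allows [F^T] to be cancelled on the right. *)
Lemma arm_mx_frame : F^T *m F = (2^-1)%:M.
Proof.
have G : F *m F^T = 2^-1 *: (1%:M - N^-1 *: const_mx 1).
  apply/matrixP => i j; rewrite !mxE mulr1 mulrC -edot_arm.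
  by apply: eq_bigr => k _; rewrite !mxE.
have C : F^T *m const_mx 1 = 0 :> 'M_(n, n.+1).
  apply/matrixP => i j; rewrite !mxE.
  have := congr1 (fun v : 'rV_n => v 0 i) sum_arm.
  rewrite summxE mxE => h; rewrite -[RHS]h.
  by apply: eq_bigr => k _; rewrite !mxE mulr1.
have H : (F^T *m F - (2^-1)%:M) *m F^T = 0.
  rewrite mulmxBl -mulmxA G -scalemxAr mulmxBr mulmx1 -scalemxAr C.
  by rewrite scaler0 subr0 mul_scalar_mx subrr.
apply/eqP; rewrite -subr_eq0; apply/eqP; set X := _ - _ in H *.
have [L LF] := row_fullP arm_mx_full.
by rewrite -[X]mulmx1 -[1%:M]trmx1 -LF trmx_mul mulmxA H mul0mx.
Qed.

Lemma sum_edot_arm_scale v : \sum_i edot (arm i) v *: arm i = 2^-1 *: v.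
Proof.
rewrite -mul_mx_scalar -arm_mx_frame mulmxA mulmx_sum_row.
apply: eq_bigr => i _; rewrite rowK edotC; congr (_ *: _).
by rewrite !mxE; apply: eq_bigr => k _; rewrite !mxE.
Qed.

Lemma sum_edot_arm_mul v w :
  \sum_i edot (arm i) v * edot (arm i) w = edot v w / 2.
Proof.
rewrite mulrC -edotZl -sum_edot_arm_scale edot_suml.
by apply: eq_bigr => i _; rewrite edotZl.
Qed.

(** This realizes any zero-sum family as the coordinates of a vector, so that an axis can be
    prescribed by its coordinates. *)
Lemma edot_sum_arm (a : 'I_n.+1 -> R) i : \sum_j a j = 0 ->
  edot (arm i) (2 *: \sum_j a j *: arm j) = a i.
Proof.
move=> a0; rewrite edotC edotZl edot_suml.
rewrite (eq_bigr (fun j => a j * (j == i)%:R / 2 - N^-1 / 2 * a j)); last first.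
  by move=> j _; rewrite edotZl edot_arm; field.
rewrite sumrB -mulr_sumr a0 mulr0 subr0 -mulr_suml (bigD1 i) //= eqxx big1.
  by rewrite addr0 mulr1; field.
by move=> j /negPf ->; rewrite mulr0.
Qed.

Lemma edot_proj_dist (u e : 'rV[R]_n) i : edot u u = 1 -> edot e u = 0 ->
  let z := arm i - edot (arm i) u *: u - e in
  edot z z = n%:R / (2 * N) - edot (arm i) u ^+ 2 - 2 * edot (arm i) e
             + 2 * \sum_j edot (arm j) e ^+ 2.
Proof.
move=> u1 eu z.
have -> : 2 * \sum_j edot (arm j) e ^+ 2 = edot e e.
  rewrite (eq_bigr (fun j => edot (arm j) e * edot (arm j) e)) //.
  by rewrite sum_edot_arm_mul; field.
have -> : n%:R / (2 * N) = edot (arm i) (arm i).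
  rewrite edot_arm eqxx.
  have -> : n%:R = N - 1 :> R by rewrite NE addrK.
  by rewrite /= mulr1n; field.
rewrite /z; move: (arm i) => v.
rewrite !(edotBl, edotBr) !(edotZl, edotZr) u1 eu (edotC u e) eu.
by rewrite (edotC e) (edotC u); ring.
Qed.

(** Moving the origin to the barycenter turns the center [c] into the offset to which
    [edot_proj_dist] applies. *)
Lemma proj_arm (u c : 'rV[R]_n) i :
  p i - edot (p i) u *: u - c =
  arm i - edot (arm i) u *: u - (c - barycenter + edot barycenter u *: u).
Proof. by rewrite /arm edotBl; apply/rowP => k; rewrite !mxE; ring. Qed.

End Simplex.

(** * The lower bound for every projection and a projection attaining it *)

Section Radius.
Variables (R : realType) (n : nat) (p : 'I_n.+1 -> 'rV[R]_n).
Hypothesis n_gt1 : (1 < n)%N.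
Hypothesis p_indep : affinely_independent p.
Hypothesis p_dist : forall i j, i != j -> enorm (p i - p j) = 1.

Let N : R := n.+1%:R.
Let NE : N = n%:R + 1. Proof. by rewrite /N -natr1. Qed.
Let N_gt0 : 0 < N. Proof. by rewrite ltr0n. Qed.
Let N1 : 1 + n%:R != 0 :> R. Proof. by rewrite addrC natr1 pnatr_eq0. Qed.
Let n_gt0 : 0 < n%:R :> R. Proof. by rewrite ltr0n ltnW. Qed.
Let n_neq0 : n%:R != 0 :> R. Proof. by rewrite gt_eqF. Qed.

(** For even [n] the numerator is [(2 * n - 1) ^+ 2 / (4 * n)], which recovers the square of the
    stated radius. *)
Definition sq_radius : R :=
  (n%:R - 1 + (if odd n then 0 else (4 * n%:R)^-1)) / (2 * n.+1%:R).

Lemma sq_radius_le (J : {vspace 'rV[R]_n}) (c : 'rV[R]_n) (s : R) :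
  \dim J = n.-1 -> c \in J -> 0 <= s ->
  (forall x, orth_proj J (convex_hull p) x -> enorm (x - c) <= s) ->
  sq_radius <= s ^+ 2.
Proof.
move=> dJ cJ s0 hs.
have [u u1 JE] := hyperplaneP (ltnW n_gt1) dJ.
move: cJ; rewrite JE mem_hyperplane => /eqP cu.
pose b := barycenter p; pose e := c - b + edot b u *: u.
have eu : edot e u = 0 by rewrite edotDl edotBl edotZl u1 cu; ring.
pose k := Num.sqrt (2 * N).
have k2 : k ^+ 2 = 2 * N by rewrite sqr_sqrtr // mulr_ge0 // ltW.
pose x i := k * edot (arm p i) u; pose d i := 4 * N * edot (arm p i) e.
have x1 : \sum_i x i = 0 by rewrite -mulr_sumr sum_edot_arm mulr0.
have d1 : \sum_i d i = 0 by rewrite -mulr_sumr sum_edot_arm mulr0.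
have x2 : \sum_i x i ^+ 2 = N.
  rewrite (eq_bigr (fun i => k ^+ 2 * (edot (arm p i) u * edot (arm p i) u))).
    by rewrite -mulr_sumr sum_edot_arm_mul // u1 k2; field.
  by move=> i _; rewrite /x; ring.
have dx : \sum_i d i * x i = 0.
  rewrite (eq_bigr (fun i => 4 * N * k * (edot (arm p i) e * edot (arm p i) u))).
    by rewrite -mulr_sumr sum_edot_arm_mul // eu mul0r mulr0.
  by move=> i _; rewrite /x /d; ring.
(* Scaling by [2 * N] turns the constant [n / (2 * N)] of the squared distance into [n]; removing
   [n - 1] leaves the normalized constraints. *)
pose h := 2 * N * s ^+ 2 - (n%:R - 1).
have hle i : 1 - x i ^+ 2 - d i + (\sum_j d j ^+ 2) / N / 4 <= h.
  have := hs (p i - edot (p i) u *: u).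
  rewrite enorm_le // proj_arm edot_proj_dist // => /(_ _)/wrap[].
    by exists (p i); [exact: convex_hull_vertex
                     |rewrite JE; exact: is_orth_proj_hyperplane].
  rewrite -(ler_pM2l (x := 2 * N)) ?mulr_gt0 // => H.
  have -> : h = 2 * N * s ^+ 2 - (n%:R - 1) by [].
  have -> : (\sum_j d j ^+ 2) / N / 4 = 4 * N * \sum_j edot (arm p j) e ^+ 2.
    rewrite (eq_bigr (fun j => (4 * N) ^+ 2 * edot (arm p j) e ^+ 2)).
      by rewrite -mulr_sumr; field.
    by move=> j _; rewrite exprMn.
  apply: le_trans (lerB H (lexx (n%:R - 1))); rewrite le_eqVlt; apply/orP; left.
  by rewrite /x /d exprMn k2 -/e; apply/eqP; field.
have hb : (if odd n then 0 else (4 * n%:R)^-1) <= h.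
  case: ifPn => on; first exact: mean_bound x2 d1 hle.
  exact: spread_bound x1 x2 d1 dx hle.
rewrite /sq_radius ler_pdivrMr ?mulr_gt0 //.
by rewrite addrC -lerBrDr (mulrC (s ^+ 2)); exact: hb.
Qed.

(** The [a i] serve as coordinates of the axis direction [u]: the second moment makes [u] a unit
    vector, and the third makes the offset orthogonal to it. *)
Lemma ball_of_directions (a : 'I_n.+1 -> R) :
  \sum_i a i = 0 -> \sum_i a i ^+ 2 = 2^-1 -> \sum_i a i ^+ 3 = 0 ->
  exists2 J : {vspace 'rV[R]_n}, \dim J = n.-1 & exists2 c, c \in J &
    forall y, orth_proj J (convex_hull p) y -> edot (y - c) (y - c) <=
      (n%:R - 1) / (2 * N) + (\sum_i (a i ^+ 2 - (2 * N)^-1) ^+ 2) / 2.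
Proof.
move=> a1 a2 a3.
(* These offset coordinates make [a i ^+ 2 + 2 * t i] independent of [i], so all vertices are
   equally far from the axis. *)
pose t i : R := ((2 * N)^-1 - a i ^+ 2) / 2.
have t1 : \sum_i t i = 0.
  rewrite -mulr_suml sumrB a2 sumr_const card_ord -[_ *+ _]mulr_natl.
  by field.
pose u := 2 *: \sum_j a j *: arm p j; pose e := 2 *: \sum_j t j *: arm p j.
have au i : edot (arm p i) u = a i by exact: edot_sum_arm.
have te i : edot (arm p i) e = t i by exact: edot_sum_arm.
have u1 : edot u u = 1.
  have := sum_edot_arm_mul p_indep p_dist u u.
  under eq_bigr do rewrite au -expr2.
  by rewrite a2; lra.
have eu : edot e u = 0.
  have := sum_edot_arm_mul p_indep p_dist e u.
  rewrite (eq_bigr (fun i => (4 * N)^-1 * a i - 2^-1 * a i ^+ 3)); last first.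
    by move=> i _; rewrite au te /t; field.
  by rewrite sumrB -!mulr_sumr a1 a3 !mulr0; lra.
have u0 : u != 0.
  by apply/eqP => u0; move: u1; rewrite u0 edot0l => /eqP; rewrite eq_sym oner_eq0.
pose b := barycenter p; pose c := e + b - edot b u *: u.
have ce : c - b + edot b u *: u = e.
  by rewrite /c; apply/rowP => k; rewrite !mxE; ring.
exists (hyperplane u); first exact: dim_hyperplane.
exists c.
  by rewrite mem_hyperplane edotBl edotDl edotZl u1 eu mulr1 add0r subrr.
move=> y [x [al [al0 al1 ->]]] hy.
rewrite (is_orth_proj_uniq hy (is_orth_proj_hyperplane _ u1)).
pose z i := p i - edot (p i) u *: u - c.
have -> : \sum_i al i *: p i - edot (\sum_i al i *: p i) u *: u - c =
    \sum_i al i *: z i.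
  rewrite [RHS](eq_bigr (fun i => al i *: p i - edot (al i *: p i) u *: u
    - al i *: c)); last by move=> i _; rewrite !scalerBr scalerA edotZl.
  by rewrite !sumrB -!scaler_suml al1 scale1r -edot_suml.
apply: edot_convex_le => // i; rewrite /z proj_arm ce edot_proj_dist // au te.
under eq_bigr do rewrite te.
rewrite (eq_bigr (fun j => (a j ^+ 2 - (2 * N)^-1) ^+ 2 / 4)); last first.
  by move=> j _; rewrite /t; field.
by rewrite -mulr_suml /t le_eqVlt; apply/orP; left; apply/eqP; field.
Qed.

Lemma alternating_sum0 (m : nat) :
  ~~ odd m -> \sum_(i < m) (-1) ^+ i = 0 :> R.
Proof.
move=> em; rewrite -(even_halfK em).
elim: (m./2) => [|k IH]; first by rewrite big_ord0.
by rewrite doubleS !big_ord_recr /= IH add0r exprS mulN1r subrr.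
Qed.

Lemma directions_exist : exists a : 'I_n.+1 -> R,
  [/\ \sum_i a i = 0, \sum_i a i ^+ 2 = 2^-1, \sum_i a i ^+ 3 = 0 &
    (n%:R - 1) / (2 * N) + (\sum_i (a i ^+ 2 - (2 * N)^-1) ^+ 2) / 2
      = sq_radius].
Proof.
(* [m] is the number of nonzero coordinates, taken even so that alternating signs cancel; for even
   [n] the last coordinate is [0]. *)
pose m := if odd n then n.+1 else n.
have m_even : ~~ odd m by rewrite /m; case: ifP => //= ->.
have m0 : 0 < m%:R :> R by rewrite ltr0n /m; case: ifP => // _; exact: ltnW.
have mn : (m <= n.+1)%N by rewrite /m; case: ifP.
pose s : R := (Num.sqrt (2 * m%:R))^-1.
have s2 : s ^+ 2 = (2 * m%:R)^-1.
  by rewrite exprVn sqr_sqrtr // mulr_ge0 // ltW.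
pose a (i : 'I_n.+1) := if (i < m)%N then s * (-1) ^+ i else 0.
have sum_a (f : R -> R) : f 0 = 0 ->
    \sum_i f (a i) = \sum_(i < m) f (s * (-1) ^+ i).
  move=> f0; rewrite (big_ord_widen _ (fun i => f (s * (-1) ^+ i)) mn).
  rewrite [RHS]big_mkcond /=.
  by apply: eq_bigr => i _; rewrite /a; case: ifP.
have sq k : (s * (-1) ^+ k) ^+ 2 = (2 * m%:R)^-1 :> R.
  by rewrite exprMn s2 sqrr_sign mulr1.
have a1 : \sum_i a i = 0.
  by rewrite (sum_a id) // -mulr_sumr alternating_sum0 // mulr0.
have a2 : \sum_i a i ^+ 2 = 2^-1.
  rewrite (sum_a (fun t => t ^+ 2)) ?expr0n //.
  under eq_bigr do rewrite sq.
  by rewrite sumr_const card_ord -[_ *+ _]mulr_natl; field; rewrite gt_eqF.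
exists a; split => //.
  rewrite (sum_a (fun t => t ^+ 3)) ?expr0n //.
  under eq_bigr do rewrite exprS sq mulrAC.
  by rewrite -mulr_sumr alternating_sum0 // mulr0.
(* Splitting off the constant term leaves a function vanishing at [0], as [sum_a] requires. *)
pose g (t : R) := t ^+ 4 - N^-1 * t ^+ 2.
have -> : \sum_i (a i ^+ 2 - (2 * N)^-1) ^+ 2 = \sum_i g (a i) + (4 * N)^-1.
  rewrite (eq_bigr (fun i => g (a i) + ((2 * N)^-1) ^+ 2)); last first.
    by move=> i _; rewrite /g; field.
  rewrite big_split /=; congr (_ + _).
  by rewrite sumr_const card_ord -[_ *+ _]mulr_natl; field.
rewrite (sum_a g); last by rewrite /g !expr0n /= mulr0 subr0.
rewrite (eq_bigr (fun=> (2 * m%:R)^-1 ^+ 2 - N^-1 * (2 * m%:R)^-1)); last first.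
  by move=> i _; rewrite /g (exprM _ 2 2) sq.
rewrite sumr_const card_ord -[_ *+ _]mulr_natl /sq_radius /m.
by case: ifP => _; field; rewrite ?N1 ?n_neq0.
Qed.

End Radius.

Theorem theorem2 (R : realType) (n : nat) (hn : (2 <= n)%N)
    (T : set 'rV[R]_n) (hT : regular_simplex 1 T) :
  is_outer_radius n.-1 T
    (if odd n then Num.sqrt ((n%:R - 1) / (2 * (n%:R + 1)))
     else (2 * n%:R - 1) / (2 * Num.sqrt (2 * n%:R * (n%:R + 1)))).
Proof.
case: hT => p [p_indep p_dist ->]; set r : R := if _ then _ else _.
have n2 : 2 <= n%:R :> R by rewrite ler_nat.
have [r0 r2] : 0 <= r /\ r ^+ 2 = sq_radius R n.
  have n0 : n%:R != 0 :> R by rewrite gt_eqF; lra.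
  have n10 : 1 + n%:R != 0 :> R by rewrite gt_eqF; lra.
  rewrite /r /sq_radius; case: ifP => _; split.
  - exact: sqrtr_ge0.
  - rewrite sqr_sqrtr; last by rewrite divr_ge0; lra.
    by field.
  - by rewrite divr_ge0 ?mulr_ge0 ?sqrtr_ge0; lra.
  rewrite expr_div_n exprMn sqr_sqrtr; last by rewrite !mulr_ge0; lra.
  by field; rewrite n0 n10.
(* This bound is used twice: for minimality among the balls in the chosen [J], and among all
   subspaces. *)
have le_r J c s : \dim J = n.-1 -> c \in J -> 0 <= s ->
    (forall x, orth_proj J (convex_hull p) x -> enorm (x - c) <= s) -> r <= s.
  move=> dJ cJ s0 hs; rewrite -ler_sqr ?nnegrE // r2.
  exact: sq_radius_le hs.
have [a [a1 a2 a3 ar]] := directions_exist R hn.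
have [J dJ [c cJ hc]] := ball_of_directions p_indep p_dist a1 a2 a3.
rewrite ar in hc.
split; last by move=> s [K dK [[s0 [k kK hk]] _]]; exact: le_r hk.
exists J => //; split; last by move=> s [s0 [k kJ hk]]; exact: le_r hk.
split=> //; exists c => // y hy; rewrite enorm_le // r2; exact: hc.
Qed.
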